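(* Let $(V,\omega)$ be a weak symplectic vector space and let $C\subseteq V$ be a coisotropic subspace. Suppose there are a complement $C^c$ to $C$ in $V$ (so $V=C\oplus C^c$) and a complement $C'$ to $C^\omega$ in $C$ (so $C=C^\omega\oplus C'$) such that (1) $C^c$ is isotropic, and (2) $C'$ and $C^c$ are symplectically orthogonal, i.e. $\omega(x,y)=0$ for all $x\in C'$, $y\in C^c$. Then the reduction relation $L_C=\{(x,[x]) : x\in C\}$ is a split Lagrangian subspace of $\overline V\oplus\underline C$.
   Context: All vector spaces are real topological vector spaces, and $V^*$ denotes the space of continuous linear functionals on $V$. A weak symplectic vector space is a space $V$ with a skew-symmetric bilinear form $\omega$ such that $\omega^\sharp(v)=\omega(v,\cdot)$ defines an injective linear map $\omega^\sharp:V\to V^*$. For a subspace $W$, $W^\omega=\{v\in V:\omega(v,w)=0\ \forall w\in W\}$. A subspace $L$ is isotropic if $L\subseteq L^\omega$, coisotropic if $L^\omega\subseteq L$, Lagrangian if $L=L^\omega$, and split Lagrangian if it is Lagrangian and has a Lagrangian complement. $\overline V$ denotes $V$ with the form $-\omega$, and direct sums carry the direct sum of the forms. For $C$ coisotropic, $\underline C=C/C^\omega$ is the symplectic reduction, with the induced form $\underline\omega([x],[y])=\omega(x,y)$, and $[x]$ is the class of $x\in C$. *)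

(* Defs.v *)
From HB Require Import structures.
From mathcomp Require Import all_boot all_order all_algebra all_classical all_reals.
From mathcomp Require Import topology normedtype.
Import GRing.Theory.
Import numFieldNormedType.Exports.
Set Implicit Arguments.
Unset Strict Implicit.
Unset Printing Implicit Defensive.
Local Open Scope classical_set_scope.
Local Open Scope quotient_scope.
Local Open Scope ring_scope.

(* A subspace of a vector space [V] is a term of type [submodClosed V]; with
    classical logic every linear subspace is of this form.  Subspaces are not
    required to be closed, and direct sums of subspaces are algebraic. *)

(* [tvsType] is not used because it requires local convexity; this is also why
   the product topology on pairs is transported to an alias: mathcomp-analysis
   only provides the topological vector space structure on pairs of tvsType. *)
Definition dsum (E F : Type) : Type := (E * F)%type.

Section DirectSum.
Context (R : realType) (E F : topologicalLmodType R).

HB.instance Definition _ := Topological.copy (dsum E F) (E * F)%type.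
HB.instance Definition _ := GRing.Lmodule.copy (dsum E F) (E * F)%type.

Lemma dsum_add_continuous :
  continuous (fun z : dsum E F * dsum E F => z.1 + z.2).
Proof.
move=> [[x1 y1] [x2 y2]] U [[A B] /= [nA nB] nU].
have [[A1 A2] /= [A1x A2x] sA] := @add_continuous E (x1, x2) _ nA.
have [[B1 B2] /= [B1y B2y] sB] := @add_continuous F (y1, y2) _ nB.
exists (A1 `*` B1, A2 `*` B2); first by split; [exists (A1, B1)|exists (A2, B2)].
move=> [[a1 b1] [a2 b2]] /= [[/= Aa1 Bb1] [/= Aa2 Bb2]].
by apply: nU; split; [exact: (sA (a1, a2))|exact: (sB (b1, b2))].
Qed.

Lemma dsum_scale_continuous :
  continuous (fun z : R^o * dsum E F => z.1 *: z.2).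
Proof.
move=> [r [x y]] U [[A B] /= [nA nB] nU].
have [[A1 A2] /= [A1r A2x] sA] := @scale_continuous R E (r, x) _ nA.
have [[B1 B2] /= [B1r B2y] sB] := @scale_continuous R F (r, y) _ nB.
exists (A1 `&` B1, A2 `*` B2).
  by split; [exact: filterI|exists (A2, B2)].
move=> [l [a b]] /= [[Al Bl] [/= Aa Bb]].
by apply: nU; split; [exact: (sA (l, a))|exact: (sB (l, b))].
Qed.

HB.instance Definition _ :=
  PreTopologicalNmodule_isTopologicalNmodule.Build (dsum E F)
    dsum_add_continuous.
HB.instance Definition _ :=
  TopologicalNmodule_isTopologicalLmodule.Build R (dsum E F)
    dsum_scale_continuous.

End DirectSum.

Definition subsp (R : realType) (V : topologicalLmodType R)
  (C : submodClosed V) : Type := {x : V | x \in C}.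

Section Subspace.
Context (R : realType) (V : topologicalLmodType R) (C : submodClosed V).

HB.instance Definition _ := SubChoice.copy (subsp C) {x : V | x \in C}.
HB.instance Definition _ := [SubChoice_isSubLmodule of subsp C by <:].
HB.instance Definition _ :=
  Topological.copy (subsp C) (initial_topology (\val : subsp C -> V)).

Lemma subsp_val_continuous : continuous (\val : subsp C -> V).
Proof. exact: initial_continuous. Qed.

Lemma subsp_add_continuous :
  continuous (fun z : subsp C * subsp C => z.1 + z.2).
Proof.
apply: (@continuous_comp_initial _ _ _ (\val : subsp C -> V)).
have -> : \val \o (fun z : subsp C * subsp C => z.1 + z.2) =
    (fun z : V * V => z.1 + z.2) \o
    (fun z : subsp C * subsp C => (\val z.1, \val z.2)).
  by apply/funext => z; exact: raddfD.
move=> z; apply: continuous_comp; last exact: add_continuous.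
apply: cvg_pair => /=; apply: continuous_comp => //;
  [exact: cvg_fst|exact: subsp_val_continuous
  |exact: cvg_snd|exact: subsp_val_continuous].
Qed.

Lemma subsp_scale_continuous :
  continuous (fun z : R^o * subsp C => z.1 *: z.2).
Proof.
apply: (@continuous_comp_initial _ _ _ (\val : subsp C -> V)).
have -> : \val \o (fun z : R^o * subsp C => z.1 *: z.2) =
    (fun z : R^o * V => z.1 *: z.2) \o
    (fun z : R^o * subsp C => (z.1, \val z.2)).
  by apply/funext => z; exact: linearZ.
move=> z; apply: continuous_comp; last exact: scale_continuous.
apply: (@cvg_pair _ _ _ (nbhs z) (nbhs (z.1 : R^o)) (nbhs (\val z.2))).
  exact: cvg_fst.
by apply: continuous_comp; [exact: cvg_snd|exact: subsp_val_continuous].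
Qed.

HB.instance Definition _ :=
  PreTopologicalNmodule_isTopologicalNmodule.Build (subsp C)
    subsp_add_continuous.
HB.instance Definition _ :=
  TopologicalNmodule_isTopologicalLmodule.Build R (subsp C)
    subsp_scale_continuous.

End Subspace.

(* A [submodClosed] predicate is not canonically a [zmodClosed] one, since the
   former also makes sense for semimodules. *)
Definition zmod_of (R : realType) (V : topologicalLmodType R)
  (I : submodClosed V) : {pred V} := I.

Section ZmodOf.
Context (R : realType) (V : topologicalLmodType R) (I : submodClosed V).

Lemma zmod_of_closed : zmod_closed (zmod_of I).
Proof.
split=> [|x y xI yI]; first exact: (rpred0 I).
by rewrite addrC -scaleN1r; exact: (submodClosedP I).2.
Qed.

HB.instance Definition _ := GRing.isZmodClosed.Build V (zmod_of I)
  zmod_of_closed.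

End ZmodOf.

Definition quot_space (R : realType) (V : topologicalLmodType R)
  (I : submodClosed V) : Type :=
  quotient_topology (Quotient.quot (zmod_of I)).

Section QuotientSpace.
Context (R : realType) (V : topologicalLmodType R) (I : submodClosed V).
Local Notation Q := (quot_space I).
Local Notation Q0 := (Quotient.quot (zmod_of I)).

HB.instance Definition _ := Quotient.copy Q (quotient_topology Q0).
HB.instance Definition _ := Topological.copy Q (quotient_topology Q0).
HB.instance Definition _ := GRing.isZmodule.Build Q
  (@Quotient.addqA V (zmod_of I)) (@Quotient.addqC V (zmod_of I))
  (@Quotient.add0q V (zmod_of I)) (@Quotient.addNq V (zmod_of I)).

Definition quot_pi (x : V) : Q := \pi_Q0 x.

Lemma quot_piP (x y : V) : quot_pi x = quot_pi y <-> x - y \in I.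
Proof.
rewrite -[_ \in I]/(x - y \in zmod_of I) Quotient.idealrBE.
by split=> [xy|/eqP//]; apply/eqP.
Qed.

Lemma quot_reprK (p : Q) : quot_pi (repr p) = p.
Proof. exact: reprK. Qed.

Lemma quot_repr_pi (x : V) : repr (quot_pi x) - x \in I.
Proof. by apply/quot_piP; rewrite quot_reprK. Qed.

Lemma quot_piD (x y : V) : quot_pi (x + y) = quot_pi x + quot_pi y.
Proof. exact: (@Quotient.pi_add V (zmod_of I)). Qed.

Definition quot_scale (a : R) (p : Q) : Q := quot_pi (a *: repr p).

Lemma quot_piZ a (x : V) : quot_pi (a *: x) = quot_scale a (quot_pi x).
Proof.
apply/esym/quot_piP; rewrite -scalerBr; apply: rpredZ; exact: quot_repr_pi.
Qed.

Lemma quot_scaleA a b (p : Q) :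
  quot_scale a (quot_scale b p) = quot_scale (a * b) p.
Proof. by rewrite -[p]quot_reprK -!quot_piZ scalerA. Qed.

Lemma quot_scale1 : left_id 1 quot_scale.
Proof. by move=> p; rewrite -[p]quot_reprK -quot_piZ scale1r. Qed.

Lemma quot_scaleDr : right_distributive quot_scale +%R.
Proof.
move=> a p q; rewrite -[p]quot_reprK -[q]quot_reprK.
by rewrite -quot_piD -!quot_piZ -quot_piD scalerDr.
Qed.

Lemma quot_scaleDl (p : Q) : {morph quot_scale^~ p : a b / a + b}.
Proof.
by move=> a b; rewrite -[p]quot_reprK -!quot_piZ -quot_piD scalerDl.
Qed.

HB.instance Definition _ := GRing.Zmodule_isLmodule.Build R Q
  quot_scaleA quot_scale1 quot_scaleDr quot_scaleDl.

Lemma quot_pi_is_linear : linear quot_pi.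
Proof. by move=> a x y; rewrite quot_piD quot_piZ. Qed.

HB.instance Definition _ :=
  GRing.isLinear.Build R V Q *:%R quot_pi quot_pi_is_linear.

Lemma quot_pi_continuous : continuous quot_pi.
Proof. exact: pi_continuous. Qed.

Lemma quot_spaceP (Z : topologicalType) (f : Q -> Z) :
  continuous (f \o quot_pi) -> continuous f.
Proof. by move=> cf; apply/(@quotient_continuous V Q0 Z f). Qed.

Lemma quot_pi_nbhs (x : V) (A : set V) :
  nbhs x A -> nbhs (quot_pi x) (quot_pi @` A).
Proof.
rewrite nbhsE => -[B [oB Bx] BA].
rewrite nbhsE; exists (quot_pi @` B); last exact: image_subset.
split; last by exists x.
suff : open (quot_pi @^-1` (quot_pi @` B)) by [].
rewrite openE => z [b Bb /quot_piP bz]; rewrite /interior.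
have tr : {for z, continuous (fun w : V => w + (b - z))}.
  apply: (@continuous_comp _ _ _ (fun w : V => (w, b - z))
    (fun w : V * V => w.1 + w.2)); last exact: add_continuous.
  by apply: cvg_pair; [exact: cvg_id|exact: cvg_cst].
have nB : nbhs (z + (b - z)) B.
  by rewrite addrC subrK; apply: open_nbhs_nbhs.
apply: (@filterS _ (nbhs z) _ _ _ _ (tr _ nB)) => w /= Bw; exists (w + (b - z)) => //.
by apply/quot_piP; rewrite addrC addKr.
Qed.

Lemma quot_add_continuous : continuous (fun z : Q * Q => z.1 + z.2).
Proof.
move=> [p q]; rewrite -[p]quot_reprK -[q]quot_reprK => U /=.
rewrite -quot_piD => /quot_pi_continuous.
move=> /(@add_continuous V (repr p, repr q))[[A B] /= [nA nB] sU].
exists (quot_pi @` A, quot_pi @` B); first by split; exact: quot_pi_nbhs.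
move=> [_ _] /= [[a Aa <-] [b Bb <-]]; rewrite -quot_piD.
exact: (sU (a, b)).
Qed.

Lemma quot_scale_continuous : continuous (fun z : R^o * Q => z.1 *: z.2).
Proof.
move=> [r q]; rewrite -[q]quot_reprK => U /=.
rewrite -linearZ/= => /quot_pi_continuous.
move=> /(@scale_continuous R V (r, repr q))[[A B] /= [nA nB] sU].
exists (A, quot_pi @` B); first by split => //; exact: quot_pi_nbhs.
move=> [a _] /= [Aa [b Bb <-]]; rewrite -linearZ/=.
exact: (sU (a, b)).
Qed.

HB.instance Definition _ :=
  PreTopologicalNmodule_isTopologicalNmodule.Build Q quot_add_continuous.
HB.instance Definition _ :=
  TopologicalNmodule_isTopologicalLmodule.Build R Q quot_scale_continuous.

End QuotientSpace.

(* [omega v] is linear by bilinearity, so [sharp_continuous] says that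
   omega^sharp : v |-> omega v takes its values in the continuous dual, and
   [sharp_inj] that it is injective. *)
Record weak_symplectic (R : realType) (V : topologicalLmodType R) :=
  WeakSymplectic {
    symp_form :> {skew_symmetric V} ;
    sharp_continuous : forall v : V, continuous (symp_form v : V -> R) ;
    sharp_inj : injective (symp_form : V -> V -> R)
  }.

Section SymplecticTheory.
Context (R : realType) (V : topologicalLmodType R) (omega : weak_symplectic V).

Lemma symp_linl a (x y z : V) :
  omega (a *: x + y) z = a * omega x z + omega y z.
Proof. exact: (linearPl (symp_form omega)). Qed.

Lemma symp_linr a (x y z : V) :
  omega z (a *: x + y) = a * omega z x + omega z y.
Proof. exact: (linearPr (symp_form omega)). Qed.

Lemma symp0l (z : V) : omega 0 z = 0.
Proof. exact: (linear0l (symp_form omega)). Qed.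

Lemma symp_skew (x y : V) : omega x y = - omega y x.
Proof. by have := hermitian_subproof (s := omega) x y; rewrite mulN1r. Qed.

End SymplecticTheory.

Section SymplecticSubspaces.
Context (R : realType) (V : topologicalLmodType R).
Implicit Types (omega : weak_symplectic V).

Definition orth omega (W : {pred V}) : {pred V} :=
  [pred v | `[< forall w, w \in W -> omega v w = 0 >]].

Lemma orthP omega (W : {pred V}) (v : V) :
  reflect (forall w, w \in W -> omega v w = 0) (v \in orth omega W).
Proof. exact: asboolP. Qed.

Lemma orth_submod_closed omega (W : {pred V}) : submod_closed (orth omega W).
Proof.
split=> [|a x y /orthP xW /orthP yW]; apply/orthP => w wW.
  exact: symp0l.
by rewrite symp_linl xW// yW// mulr0 addr0.
Qed.

HB.instance Definition _ omega (W : {pred V}) :=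
  GRing.isSubmodClosed.Build R V (orth omega W) (orth_submod_closed omega W).

Definition isotropic omega (L : submodClosed V) : Prop :=
  {subset L <= orth omega L}.

Definition coisotropic omega (L : submodClosed V) : Prop :=
  {subset orth omega L <= L}.

Definition lagrangian omega (L : submodClosed V) : Prop :=
  L =i orth omega L.

(* W is the (internal, algebraic) direct sum of A and B. *)
Definition is_direct_sum (W A B : {pred V}) : Prop :=
  (forall x, x \in A -> x \in B -> x = 0) /\
  (forall x, x \in W <-> exists a b, [/\ a \in A, b \in B & x = a + b]).

Definition split_lagrangian omega (L : submodClosed V) : Prop :=
  lagrangian omega L /\
  exists M : submodClosed V, lagrangian omega M /\ is_direct_sum predT L M.

End SymplecticSubspaces.

Section Opposite.
Context (R : realType) (V : topologicalLmodType R) (omega : weak_symplectic V).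

Definition opp_form (x y : V) : R := - omega x y.

Lemma opp_form_bilinear : bilinear_for *%R (idfun \; *%R) opp_form.
Proof.
split=> z a x y; rewrite /opp_form.
  by rewrite symp_linl opprD -mulrN.
by rewrite symp_linr opprD /= -mulrN.
Qed.

HB.instance Definition _ := bilinear_isBilinear.Build R V V R
  *%R (idfun \; *%R) opp_form opp_form_bilinear.

Lemma opp_form_skew (x y : V) :
  opp_form x y = (-1) ^+ true * idfun (opp_form y x).
Proof. by rewrite /opp_form symp_skew mulN1r. Qed.

HB.instance Definition _ :=
  isHermitianSesquilinear.Build R V true idfun opp_form opp_form_skew.

Lemma opp_form_continuous (v : V) : continuous (opp_form v).
Proof. by move=> x; apply: cvgN; exact: sharp_continuous. Qed.

Lemma opp_form_inj : injective opp_form.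
Proof.
move=> x y xy; apply: (@sharp_inj _ _ omega); apply/funext => z.
by have /oppr_inj := congr1 (fun f => f z) xy.
Qed.

Definition opp_symp : weak_symplectic V :=
  WeakSymplectic opp_form_continuous opp_form_inj.

End Opposite.

Section SumForm.
Context (R : realType) (V W : topologicalLmodType R).
Context (omega1 : weak_symplectic V) (omega2 : weak_symplectic W).

Definition sum_form (x y : dsum V W) : R := omega1 x.1 y.1 + omega2 x.2 y.2.

Lemma sum_form_bilinear : bilinear_for *%R (idfun \; *%R) sum_form.
Proof.
split=> z a x y; rewrite /sum_form /=.
  by rewrite !symp_linl mulrDr addrACA.
by rewrite !symp_linr mulrDr addrACA.
Qed.

HB.instance Definition _ := bilinear_isBilinear.Build R (dsum V W) (dsum V W) R
  *%R (idfun \; *%R) sum_form sum_form_bilinear.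

Lemma sum_form_skew (x y : dsum V W) :
  sum_form x y = (-1) ^+ true * idfun (sum_form y x).
Proof.
by rewrite /sum_form mulN1r /= opprD; congr +%R; rewrite symp_skew.
Qed.

HB.instance Definition _ :=
  isHermitianSesquilinear.Build R (dsum V W) true idfun sum_form sum_form_skew.

Lemma sum_form_continuous (v : dsum V W) : continuous (sum_form v).
Proof.
move=> x; apply: cvgD.
  by apply: (@continuous_comp _ _ _ (fst : V * W -> V) (omega1 v.1));
    [exact: cvg_fst|exact: sharp_continuous].
by apply: (@continuous_comp _ _ _ (snd : V * W -> W) (omega2 v.2));
  [exact: cvg_snd|exact: sharp_continuous].
Qed.

Lemma sum_form_inj : injective sum_form.
Proof.
move=> [x1 x2] [y1 y2] xy; congr (_, _).
  apply: (@sharp_inj _ _ omega1); apply/funext => z.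
  have := congr1 (fun f => f (z, 0)) xy.
  by rewrite /sum_form/= ![omega2 _ 0]symp_skew !symp0l oppr0 !addr0.
apply: (@sharp_inj _ _ omega2); apply/funext => z.
have := congr1 (fun f => f (0, z)) xy.
by rewrite /sum_form/= ![omega1 _ 0]symp_skew !symp0l oppr0 !add0r.
Qed.

Definition sum_symp : weak_symplectic (dsum V W) :=
  WeakSymplectic sum_form_continuous sum_form_inj.

End SumForm.

Section Reduction.
Context (R : realType) (V : topologicalLmodType R) (omega : weak_symplectic V).
Context (C : submodClosed V).

(* C^omega as a subspace of C; it is the intersection of C and C^omega, so that
   the reduction below is C / C^omega when C is coisotropic. *)
Definition orth_in : {pred subsp C} := [pred x | \val x \in orth omega C].

Lemma orth_in_closed : submod_closed orth_in.
Proof.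
split=> [|a x y /orthP xO /orthP yO]; apply/orthP => w wC.
  by rewrite raddf0 symp0l.
by rewrite linearP symp_linl xO// yO// mulr0 addr0.
Qed.

HB.instance Definition _ :=
  GRing.isSubmodClosed.Build R (subsp C) orth_in orth_in_closed.

Definition reduction : topologicalLmodType R := quot_space orth_in.

Definition red_class (x : subsp C) : reduction := quot_pi orth_in x.

Definition red_form (p q : reduction) : R :=
  omega (\val (repr p)) (\val (repr q)).

Lemma red_classK (p : reduction) : red_class (repr p) = p.
Proof. exact: quot_reprK. Qed.

Lemma red_classE (x y : subsp C) :
  red_class x = red_class y <-> \val x - \val y \in orth omega C.
Proof.
have -> : (\val x - \val y \in orth omega C) = (x - y \in orth_in).
  by rewrite -[x - y \in _]/(\val (x - y) \in orth omega C) raddfB.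
exact: quot_piP.
Qed.

Lemma red_formE (x y : subsp C) :
  red_form (red_class x) (red_class y) = omega (\val x) (\val y).
Proof.
have red_l (a b c : subsp C) : red_class a = red_class b ->
    omega (\val a) (\val c) = omega (\val b) (\val c).
  move=> /red_classE/orthP/(_ _ (valP c)) ab.
  rewrite -[\val a](subrK (\val b)) -[X in X + _]scale1r symp_linl ab.
  by rewrite mulr0 add0r.
rewrite /red_form (red_l _ x) ?red_classK//.
by rewrite symp_skew (red_l _ y) ?red_classK// -symp_skew.
Qed.

Lemma red_form_bilinear : bilinear_for *%R (idfun \; *%R) red_form.
Proof.
have redP a (p q : reduction) :
    a *: p + q = red_class (a *: repr p + repr q).
  by rewrite -{1}[p]red_classK -{1}[q]red_classK [RHS]linearP.
split=> r a p q /=; rewrite redP -[r]red_classK.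
  rewrite -{2}[p]red_classK -{2}[q]red_classK !red_formE.
  by rewrite linearP symp_linl.
rewrite -{2}[p]red_classK -{2}[q]red_classK !red_formE.
by rewrite linearP.
Qed.

HB.instance Definition _ := bilinear_isBilinear.Build R reduction reduction R
  *%R (idfun \; *%R) red_form red_form_bilinear.

Lemma red_form_skew (p q : reduction) :
  red_form p q = (-1) ^+ true * idfun (red_form q p).
Proof. by rewrite /red_form mulN1r symp_skew. Qed.

HB.instance Definition _ :=
  isHermitianSesquilinear.Build R reduction true idfun red_form red_form_skew.

Lemma red_form_continuous (p : reduction) : continuous (red_form p).
Proof.
apply: quot_spaceP.
have -> : red_form p \o quot_pi orth_in =
    omega (\val (repr p)) \o (\val : subsp C -> V).
  by apply/funext => x /=; rewrite -[p in LHS]red_classK red_formE.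
move=> x; apply: continuous_comp; first exact: subsp_val_continuous.
exact: sharp_continuous.
Qed.

Lemma red_form_inj : injective red_form.
Proof.
move=> p q pq; rewrite -[p]red_classK -[q]red_classK; apply/red_classE.
apply/orthP => w wC; pose w' : subsp C := Sub w wC.
have := congr1 (fun f => f (red_class w')) pq.
rewrite -{1}[p]red_classK -{1}[q]red_classK !red_formE SubK => pqw.
rewrite addrC -scaleN1r symp_linl pqw mulN1r addrC; exact: subrr.
Qed.

Definition red_symp : weak_symplectic reduction :=
  WeakSymplectic red_form_continuous red_form_inj.

Definition red_rel : {pred dsum V reduction} :=
  [pred z | `[< exists x : subsp C, z = (\val x, red_class x) >]].

Lemma red_rel_closed : submod_closed red_rel.
Proof.
split=> [|a _ _ /asboolP[x ->] /asboolP[y ->]]; apply/asboolP.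
  by exists 0; rewrite raddf0 /red_class raddf0.
by exists (a *: x + y); rewrite linearP /red_class linearP.
Qed.

HB.instance Definition _ :=
  GRing.isSubmodClosed.Build R (dsum V reduction) red_rel red_rel_closed.

End Reduction.

Arguments red_rel {R V} omega C.

(* Main.v *)
(** Write V = C^omega + C' + C^c and let q : C -> C / C^omega be the projection.
    The complement of L_C is M = {(x + y, - q x) : x in C', y in C^c}, which is
    isotropic by (1) and (2).  It is complementary to L_C because q restricts to
    an isomorphism on C' and 2 is invertible: for x, x' in C', one solves
    u + w = x, u - w = x'.  Finally, two complementary isotropic subspaces are
    both Lagrangian, by nondegeneracy of the form. *)

Require Import Defs.
From HB Require Import structures.
From mathcomp Require Import all_boot all_order all_algebra all_classical all_reals.
From mathcomp Require Import topology normedtype.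
Import GRing.Theory Num.Theory.
Local Open Scope ring_scope.

Section Symplectic.
Context {R : realType} {V : topologicalLmodType R} (omega : weak_symplectic V).

Lemma sympDl (x y z : V) : omega (x + y) z = omega x z + omega y z.
Proof. exact: (linearDl (symp_form omega)). Qed.

Lemma sympDr (x y z : V) : omega z (x + y) = omega z x + omega z y.
Proof. exact: (linearDr (symp_form omega)). Qed.

Lemma sympNN (x y : V) : omega (- x) (- y) = omega x y.
Proof.
by rewrite (linearNl (symp_form omega)) (linearNr (symp_form omega)) opprK.
Qed.

Lemma symp_nondegenerate (x : V) : (forall y, omega x y = 0) -> x = 0.
Proof.
move=> x0; apply: (@sharp_inj _ _ omega); apply/funext => y.
by rewrite x0 symp0l.
Qed.

Lemma direct_sumC (A B : {pred V}) :
  is_direct_sum predT A B -> is_direct_sum predT B A.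
Proof.
move=> [AB0 ABT]; split=> [x xB xA|x]; first exact: AB0.
split=> // /ABT[a [b [aA bB ->]]].
by exists b, a; split=> //; rewrite addrC.
Qed.

(** Let v = a + b be orthogonal to A. Since A is isotropic, b is orthogonal to A as well; since B is
    isotropic, b is orthogonal to B. Hence b is orthogonal to the whole space and vanishes. *)
Lemma isotropic_direct_sum_lagrangian (A B : submodClosed V) :
  isotropic omega A -> isotropic omega B -> is_direct_sum predT A B ->
  lagrangian omega A.
Proof.
move=> isoA isoB [_ ABT] v; apply/idP/idP=> [|/orthP vA]; first exact: isoA.
have [/(_ isT)[a [b [aA bB vE]]] _] := ABT v.
suff b0 : b = 0 by rewrite vE b0 addr0.
apply: symp_nondegenerate => y.
have [/(_ isT)[a' [b' [a'A b'B ->]]] _] := ABT y.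
rewrite sympDr (orthP _ _ _ (isoB _ bB) _ b'B) addr0.
by have := vA _ a'A; rewrite vE sympDl (orthP _ _ _ (isoA _ aA) _ a'A) add0r.
Qed.

End Symplectic.

Section Complement.
Context {R : realType} {V : topologicalLmodType R} (omega : weak_symplectic V).
Context (C Cc C' : submodClosed V).

(** The minus sign makes this subspace transverse to L_C: with a plus sign, every (x, [x]) with x in
    C' would lie in both. The point x ranges over [subsp C] so that its class is defined. *)
Definition red_compl : {pred dsum V (reduction omega C)} :=
  [pred z | `[< exists (x : subsp C) (y : V), [/\ \val x \in C', y \in Cc &
    z = (\val x + y, - red_class omega x)] >]].

Lemma red_compl_closed : submod_closed red_compl.
Proof.
split=> [|a _ _ /asboolP[x [y [xC' yC ->]]] /asboolP[x' [y' [x'C' y'C ->]]]].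
  apply/asboolP; exists 0, 0; rewrite raddf0 !rpred0; split=> //.
  by rewrite /red_class raddf0 oppr0 addr0.
apply/asboolP; exists (a *: x + x'), (a *: y + y').
split; rewrite ?linearP; [by rewrite rpredD ?rpredZ|by rewrite rpredD ?rpredZ|].
congr pair; first by rewrite /= scalerDr addrACA.
by rewrite /red_class linearP /= scalerN opprD.
Qed.

HB.instance Definition _ :=
  GRing.isSubmodClosed.Build R (dsum V (reduction omega C)) red_compl
    red_compl_closed.

Local Notation Omega := (sum_symp (opp_symp omega) (red_symp omega C)).

Lemma sum_oppE (v w : V) (x y : subsp C) :
  Omega (v, red_class omega x) (w, red_class omega y) =
  omega (\val x) (\val y) - omega v w.
Proof.
rewrite -[LHS]/(- omega v w + red_form (red_class omega x) (red_class omega y)).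
by rewrite red_formE addrC.
Qed.

Lemma red_classN (x : subsp C) : - red_class omega x = red_class omega (- x).
Proof. by rewrite /red_class raddfN. Qed.

Lemma red_rel_isotropic : isotropic Omega (red_rel omega C).
Proof.
move=> _ /asboolP[x ->]; apply/orthP => _ /asboolP[y ->].
by rewrite sum_oppE subrr.
Qed.

(** The mixed terms vanish by orthogonality of C' and C^c, and the C^c term by isotropy. What
    remains is the value on C', which the reduced form cancels, being blind to a sign change in both
    arguments. *)
Lemma red_compl_isotropic : isotropic omega Cc ->
  (forall x y : V, x \in C' -> y \in Cc -> omega x y = 0) ->
  isotropic Omega red_compl.
Proof.
move=> isoCc C'Cc _ /asboolP[x [y [xC' yCc ->]]].
apply/orthP => _ /asboolP[x' [y' [x'C' y'Cc ->]]].
have valN (z : subsp C) : \val (- z) = - \val z by exact: raddfN.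
rewrite !red_classN sum_oppE !valN sympNN sympDl !sympDr.
rewrite (C'Cc _ _ xC' y'Cc) (symp_skew _ y (\val x')) (C'Cc _ _ x'C' yCc).
by rewrite (orthP _ _ _ (isoCc _ yCc) _ y'Cc) oppr0 !addr0 subrr.
Qed.

Hypothesis C_Cc : is_direct_sum predT C Cc.
Hypothesis Corth_C' : is_direct_sum C (orth omega C) C'.

Lemma red_class_repr (p : reduction omega C) :
  exists2 x : subsp C, \val x \in C' & p = red_class omega x.
Proof.
have [/(_ (valP (repr p)))[a [x [aO xC' pE]]] _] := Corth_C'.2 (\val (repr p)).
(* The inclusion of C' in C is implicit in the direct sum: take 0 as the component in C^omega. *)
have xC : x \in C.
  by apply/Corth_C'.2; exists 0, x; rewrite rpred0 add0r.
exists (Sub x xC); first by rewrite SubK.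
by rewrite -[p]red_classK; apply/red_classE; rewrite SubK pE addrK.
Qed.

Lemma red_rel_compl_direct_sum :
  is_direct_sum predT (red_rel omega C) red_compl.
Proof.
split=> [_ /asboolP[u ->] /asboolP[x [y [xC' yCc [uE qE]]]]|[v p]].
  have {}uE : \val u = \val x + y := uE.
  (* As a difference of two points of C, y lies in the intersection of C and C^c, which is zero. *)
  have yC : y \in C.
    have -> : y = \val u + (-1) *: \val x by rewrite uE scaleN1r addrC addKr.
    by rewrite rpredD ?rpredZ ?(valP u) ?(valP x).
  have y0 := C_Cc.1 _ yC yCc.
  have {}uE : u = x by apply: val_inj; move: uE; rewrite y0 addr0.
  (* The second components now give [x] = -[x], so 2x, and hence x, lies in C^omega as well as in
     C'. *)
  have x0 : \val x = 0.
    apply: Corth_C'.1 => //.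
    move: qE; rewrite uE red_classN => /red_classE.
    rewrite raddfN opprK -mulr2n -scaler_nat => x2.
    have -> : \val x = 2^-1 *: (2%:R *: \val x).
      by rewrite scalerA mulVf ?scale1r ?pnatr_eq0.
    exact: rpredZ.
  have {}x0 : x = 0 by apply: val_inj; rewrite x0 raddf0.
  by rewrite uE x0 raddf0 /red_class raddf0.
split=> // _.
have [/(_ isT)[c [y [cC yCc ->]]] _] := C_Cc.2 v.
have [x' x'C' ->] := red_class_repr p.
have [x xC' cx] := red_class_repr (red_class omega (Sub c cC)).
(* The solution of u + w = x, u - w = x' has w = (x - x')/2. *)
pose h : R := 2^-1; pose w : subsp C := h *: (x - x').
have hh (z : subsp C) : h *: z + h *: z = z.
  rewrite -mulr2n -scaler_nat scalerA mulfV ?scale1r ?pnatr_eq0//.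
(* Using c - w instead of x - w makes the first components add up to c exactly; the two have the
   same class because [c] = [x]. *)
pose u : subsp C := Sub c cC - w.
exists (\val u, red_class omega u), (\val w + y, - red_class omega w).
split; first by apply/asboolP; exists u.
  apply/asboolP; exists w, y; split=> //.
  by rewrite /w linearZ rpredZ// raddfB -scaleN1r rpredD// rpredZ.
congr pair => /=; first by rewrite addrA /u raddfB /= subrK.
have uE : red_class omega u = red_class omega (x - w).
  by rewrite /u /red_class !raddfB; congr (_ - _).
(* Here [u] - [w] is the class of x - 2w = x'. *)
rewrite uE /red_class -raddfB; congr (quot_pi _ _).
by rewrite /= -addrA -opprD /w hh opprB addrC subrK.
Qed.

End Complement.

Theorem theorem3p1 (R : realType) (V : topologicalLmodType R)
    (omega : weak_symplectic V) (C : submodClosed V)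
    (C_coisotropic : coisotropic omega C)
    (Cc C' : submodClosed V)
    (C_Cc : is_direct_sum predT C Cc)
    (Corth_C' : is_direct_sum C (orth omega C) C')
    (Cc_isotropic : isotropic omega Cc)
    (C'_Cc : forall x y : V, x \in C' -> y \in Cc -> omega x y = 0) :
  split_lagrangian (sum_symp (opp_symp omega) (red_symp omega C))
    (red_rel omega C).
Proof.
have isoL := red_rel_isotropic omega C.
have isoM := red_compl_isotropic omega C Cc C' Cc_isotropic C'_Cc.
have LM := red_rel_compl_direct_sum omega C Cc C' C_Cc Corth_C'.
split; first exact: isotropic_direct_sum_lagrangian _ _ _ isoL isoM LM.
eexists; split; last exact: LM.
exact: isotropic_direct_sum_lagrangian _ _ _ isoM isoL (direct_sumC _ _ LM).
Qed.
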